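(* Let $r(x,x^* )=c^*\bigl(K-\sum_{j=1}^g B_jx_j-\sum_{j=1}^g B_j^*x_j^*\bigr)^{-1}c$ be a minimal symmetric descriptor realization of size $d$. Let $Q$ denote the orthogonal projection of $\mathbb C^d$ onto $\operatorname{rng}B+\operatorname{rng}B^*$. Then $r$ is convex in a neighborhood of $0$ if and only if $QKQ$ is positive semidefinite.
   Context: Symmetric descriptor realization: $K\in M_d(\mathbb C)$ is a signature matrix ($K=K^*$, $K^2=I_d$), $B=(B_1,\dots,B_g)\in M_d(\mathbb C)^g$, $c\in\mathbb C^d$. For $X\in M_n(\mathbb C)^g$ put $\Lambda_B(X)=\sum_j B_j\otimes X_j$ and $\Lambda_B(X)^*=\sum_jB_j^*\otimes X_j^*$. The domain consists of those $X$ for which $K\otimes I_n-\Lambda_B(X)-\Lambda_B(X)^*$ is invertible, and then $r(X,X^* )=(c\otimes I_n)^*(K\otimes I_n-\Lambda_B(X)-\Lambda_B(X)^* )^{-1}(c\otimes I_n)$. Minimal: $\operatorname{span}\{w(B_1K,\dots,B_gK,B_1^*K,\dots,B_g^*K)c\}=\mathbb C^d$, where $w$ ranges over all words (including the empty word) in $2g$ freely noncommuting letters. $\operatorname{rng}B$ is the span of the ranges of $B_1,\dots,B_g$, and $\operatorname{rng}B^*$ is the span of the ranges of $B_1^*,\dots,B_g^*$. Free ball: $\mathbb B_\varepsilon(n)=\{X\in M_n(\mathbb C)^g:\sum_j X_j^*X_j\prec\varepsilon^2 I_n\}$, $\mathbb B_\varepsilon=(\mathbb B_\varepsilon(n))_n$.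 Convex: $r$ is convex in a neighborhood of $0$ if there is $\varepsilon>0$ such that $\mathbb B_\varepsilon$ lies in the domain of $r$ and, with $F(X)=r(X,X^* )$, $\frac{F(X)+F(Y)}2-F\left(\frac{X+Y}2\right)\succeq0$ for all $n$ and all $X,Y\in\mathbb B_\varepsilon(n)$. *)

(* Defs.v *)
From mathcomp Require Import all_boot all_order all_algebra.
From mathcomp Require Import complex mxtens.
From mathcomp Require Import reals.

Set Implicit Arguments.
Unset Strict Implicit.
Unset Printing Implicit Defensive.

Import Order.TTheory GRing.Theory Num.Theory.
Local Open Scope ring_scope.
Local Open Scope sesquilinear_scope.

(* In a numClosedFieldType C (here the complex numbers), 0 <= z and 0 < z
   both include the condition that z is real. *)

Definition possemidef (C : numClosedFieldType) n (A : 'M[C]_n) : Prop :=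
  A \is hermsymmx /\ forall v : 'cV[C]_n, 0 <= (v^t* *m A *m v) 0 0.

Definition posdef (C : numClosedFieldType) n (A : 'M[C]_n) : Prop :=
  A \is hermsymmx /\ forall v : 'cV[C]_n, v != 0 -> 0 < (v^t* *m A *m v) 0 0.

Definition signature_mx (C : numClosedFieldType) d (K : 'M[C]_d) : Prop :=
  K \is hermsymmx /\ K *m K = 1%:M.

Definition adjt (C : numClosedFieldType) g n (X : 'I_g -> 'M[C]_n) :
  'I_g -> 'M[C]_n := fun j => (X j)^t*.

Definition Lambda (C : numClosedFieldType) g d n
    (B : 'I_g -> 'M[C]_d) (X : 'I_g -> 'M[C]_n) : 'M[C]_(d * n) :=
  \sum_(j < g) B j *t X j.

Definition pencil (C : numClosedFieldType) g d n
    (K : 'M[C]_d) (B : 'I_g -> 'M[C]_d) (X : 'I_g -> 'M[C]_n) : 'M[C]_(d * n) :=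
  K *t 1%:M - Lambda B X - Lambda (adjt B) (adjt X).

Definition in_domain (C : numClosedFieldType) g d n
    (K : 'M[C]_d) (B : 'I_g -> 'M[C]_d) (X : 'I_g -> 'M[C]_n) : Prop :=
  pencil K B X \in unitmx.

(* The size 1 * n comes from c *t 1%:M; it is n up to mul1n. Outside the domain
   invmx is the identity, so the value there has no meaning. *)
Definition realization (C : numClosedFieldType) g d n
    (K : 'M[C]_d) (B : 'I_g -> 'M[C]_d) (c : 'cV[C]_d) (X : 'I_g -> 'M[C]_n) :
    'M[C]_(1 * n) :=
  (c *t (1%:M : 'M[C]_n))^t* *m invmx (pencil K B X) *m (c *t 1%:M).

(* A word is a sequence of letters: inl j stands for B_j K, inr j for B_j^* K. *)
Definition letter_mx (C : numClosedFieldType) g d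
    (K : 'M[C]_d) (B : 'I_g -> 'M[C]_d) (l : 'I_g + 'I_g) : 'M[C]_d :=
  match l with
  | inl j => B j *m K
  | inr j => adjt B j *m K
  end.

Definition word_mx (C : numClosedFieldType) g d
    (K : 'M[C]_d) (B : 'I_g -> 'M[C]_d) (w : seq ('I_g + 'I_g)) : 'M[C]_d :=
  \big[mulmx/1%:M]_(l <- w) letter_mx K B l.

Definition minimal_realization (C : numClosedFieldType) g d
    (K : 'M[C]_d) (B : 'I_g -> 'M[C]_d) (c : 'cV[C]_d) : Prop :=
  forall v : 'cV[C]_d,
  exists (ws : seq (seq ('I_g + 'I_g))) (a : seq ('I_g + 'I_g) -> C),
    v = \sum_(w <- ws) a w *: (word_mx K B w *m c).

(* Subspaces of C^d are represented by row spaces, as in mxalgebra: the range of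
   a matrix acting on column vectors is the row space of its transpose. *)
Definition rng (C : numClosedFieldType) g d (B : 'I_g -> 'M[C]_d) : 'M[C]_d :=
  (\sum_(j < g) (B j)^T)%MS.

(* proj_ortho acts on row vectors from the right; the transpose acts on column
   vectors from the left. *)
Definition orthproj (C : numClosedFieldType) m d (U : 'M[C]_(m, d)) : 'M[C]_d :=
  (proj_ortho U)^T.

Lemma orthprojP (C : numClosedFieldType) m d (U : 'M[C]_(m, d)) :
  [/\ orthproj U \is hermsymmx, orthproj U *m orthproj U = orthproj U
    & ((orthproj U)^T :=: U)%MS].
Proof.
have PP : proj_ortho U *m proj_ortho U = proj_ortho U := proj_ortho_proj U.
have PE := proj_orthoE U.
have H : (1%:M - proj_ortho U) *m (proj_ortho U)^t* = 0.
  have := proj_ortho_compl_sub U (1%:M : 'M[C]_d); rewrite mul1mx.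
  move=> /orthomx1P; move: PE => /eqmxP/andP[/submxP[D DE] _].
  by move=> HU; rewrite {2}DE trmx_mul map_mxM mulmxA HU mul0mx.
have PS : (proj_ortho U)^t* = proj_ortho U *m (proj_ortho U)^t*.
  by apply/eqP; rewrite -subr_eq0 -{1}[_^t*]mul1mx -mulmxBl H.
have PH : (proj_ortho U)^t* = proj_ortho U.
  have adjM (A B : 'M[C]_d) : (A *m B)^t* = B^t* *m A^t*.
    by rewrite trmx_mul map_mxM.
  have E : (proj_ortho U)^t*^t* = (proj_ortho U *m (proj_ortho U)^t*)^t*.
    by rewrite -PS.
  by rewrite adjM !trmxCK -PS in E.
split; last by rewrite trmxK.
  apply/is_hermitianmxP; rewrite expr0 scale1r /orthproj trmxK.
  by rewrite -{1}PH map_trmx trmxK.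
by rewrite /orthproj -trmx_mul PP.
Qed.

Definition free_ball (C : numClosedFieldType) g (eps : C) n
    (X : 'I_g -> 'M[C]_n) : Prop :=
  posdef ((eps ^+ 2)%:M - \sum_(j < g) (X j)^t* *m X j).

Definition midpoint (C : numClosedFieldType) g n
    (X Y : 'I_g -> 'M[C]_n) : 'I_g -> 'M[C]_n :=
  fun j => 2^-1 *: (X j + Y j).

Definition convex_near_0 (C : numClosedFieldType) g d
    (K : 'M[C]_d) (B : 'I_g -> 'M[C]_d) (c : 'cV[C]_d) : Prop :=
  exists eps : C, [/\ 0 < eps,
    forall n (X : 'I_g -> 'M[C]_n), free_ball eps X -> in_domain K B X
  & forall n (X Y : 'I_g -> 'M[C]_n), free_ball eps X -> free_ball eps Y ->
      possemidef (2^-1 *: (realization K B c X + realization K B c Y)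
                  - realization K B c (midpoint X Y))].

(* Main.v *)
Require Import Defs.
From mathcomp Require Import all_boot all_order all_algebra.
From mathcomp Require Import complex mxtens.
From mathcomp Require Import reals.
From mathcomp Require Import ring.

(* Identify C^d (x) C^n with d x n matrices under <Z, W> = tr(Z^* W), and let L_X
   be the pencil K - A_X acting there, so that w^* r(X) w = <c w, Z> when
   L_X Z = c w. If Z_X, Z_Y and W solve this equation at X, Y and at the
   midpoint, then
     <c w, Z_X> + <c w, Z_Y> - 2 <c w, W>
        = <W - Z_X, L_X (W - Z_X)> + <W - Z_Y, L_Y (W - Z_Y)>.
   If P = QKQ is positive semidefinite: K maps the increments D = W - Z_X into
   the range of Q, so with U = K D each term is <U, PU> - <PU, A_X PU>, which is
   at least <U, PU> - <PU, PU> >= 0 for small X.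
   Conversely, pick X near 0 and a solution Z of L_X Z = c w whose column space
   is maximal. Perturbing X (+) 0 by a small multiple of an off-diagonal H
   changes Z (+) 0 to first order by 0 (+) Ku, where u = sum_j B_j Z a_j +
   adjt B j Z b_j is arbitrary of this form. Maximality puts Ku in the column space
   of Z, which is then everything by minimality; so u runs over
   rng B + rng (adjt B), and the displayed identity at X (+) 0 +- s H gives
   u^* K u >= 0 as s tends to 0. *)

Set Implicit Arguments.
Unset Strict Implicit.
Unset Printing Implicit Defensive.

Import Order.TTheory GRing.Theory Num.Theory.
Local Open Scope ring_scope.
Local Open Scope sesquilinear_scope.

(** * The trace inner product and crude norm bounds *)

Section InnerProduct.
Variable C : numClosedFieldType.

Lemma ctrM m n p (A : 'M[C]_(m, n)) (B : 'M[C]_(n, p)) :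
  (A *m B)^t* = B^t* *m A^t*.
Proof. by rewrite trmx_mul map_mxM. Qed.

Lemma ctrD m n (A B : 'M[C]_(m, n)) : (A + B)^t* = A^t* + B^t*.
Proof. by rewrite linearD map_mxD. Qed.

Lemma ctrZ m n a (A : 'M[C]_(m, n)) : (a *: A)^t* = a^* *: A^t*.
Proof. by rewrite linearZ map_mxZ. Qed.

Lemma herm_adj n (A : 'M[C]_n) : A \is hermsymmx <-> A^t* = A.
Proof.
split=> [/is_hermitianmxP|AE]; first by rewrite expr0 scale1r => {2}->.
by apply/is_hermitianmxP; rewrite expr0 scale1r AE.
Qed.

Definition ip m n (Z W : 'M[C]_(m, n)) : C := \tr (Z^t* *m W).

Lemma ipE m n (Z W : 'M[C]_(m, n)) :
  ip Z W = \sum_i \sum_j (Z j i)^* * W j i.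
Proof.
by apply: eq_bigr => i _; rewrite mxE; apply: eq_bigr => j _; rewrite !mxE.
Qed.

Lemma ip_conj m n (Z W : 'M[C]_(m, n)) : (ip Z W)^* = ip W Z.
Proof.
rewrite !ipE rmorph_sum; apply: eq_bigr => i _; rewrite rmorph_sum.
by apply: eq_bigr => j _; rewrite rmorphM /= conjCK mulrC.
Qed.

Lemma ipDr m n (Z V W : 'M[C]_(m, n)) : ip Z (V + W) = ip Z V + ip Z W.
Proof. by rewrite /ip mulmxDr mxtraceD. Qed.

Lemma ipZr m n a (Z W : 'M[C]_(m, n)) : ip Z (a *: W) = a * ip Z W.
Proof. by rewrite /ip -scalemxAr mxtraceZ. Qed.

Lemma ipNr m n (Z W : 'M[C]_(m, n)) : ip Z (- W) = - ip Z W.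
Proof. by rewrite -scaleN1r ipZr mulN1r. Qed.

Lemma ipDl m n (Z V W : 'M[C]_(m, n)) : ip (V + W) Z = ip V Z + ip W Z.
Proof. by rewrite -ip_conj ipDr rmorphD /= !ip_conj. Qed.

Lemma ipZl m n a (Z W : 'M[C]_(m, n)) : ip (a *: W) Z = a^* * ip W Z.
Proof. by rewrite -ip_conj ipZr rmorphM /= ip_conj. Qed.

Lemma ipNl m n (Z W : 'M[C]_(m, n)) : ip (- W) Z = - ip W Z.
Proof. by rewrite -ip_conj ipNr rmorphN /= ip_conj. Qed.

Definition ip_lin := (ipDr, ipDl, ipNr, ipNl).

Lemma ip_sumr m n I (r : seq I) (Z : 'M[C]_(m, n)) (F : I -> 'M[C]_(m, n)) :
  ip Z (\sum_(i <- r) F i) = \sum_(i <- r) ip Z (F i).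
Proof. by rewrite /ip mulmx_sumr raddf_sum. Qed.

Lemma ip_suml m n I (r : seq I) (Z : 'M[C]_(m, n)) (F : I -> 'M[C]_(m, n)) :
  ip (\sum_(i <- r) F i) Z = \sum_(i <- r) ip (F i) Z.
Proof.
by rewrite -ip_conj ip_sumr rmorph_sum /=; apply: eq_bigr => i _; rewrite ip_conj.
Qed.

Lemma ip_ge0 m n (Z : 'M[C]_(m, n)) : 0 <= ip Z Z.
Proof.
rewrite ipE; apply: sumr_ge0 => i _; apply: sumr_ge0 => j _.
by rewrite mulrC mul_conjC_ge0.
Qed.

Lemma ip_le0 m n (Z : 'M[C]_(m, n)) : ip Z Z <= 0 -> Z = 0.
Proof.
move=> Zle; have /eqP: ip Z Z = 0 by apply/eqP; rewrite eq_le Zle ip_ge0.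
rewrite ipE psumr_eq0 => [/allP Z0|i _]; last first.
  by apply: sumr_ge0 => j _; rewrite mulrC mul_conjC_ge0.
apply/matrixP=> j i; have:= Z0 i (mem_index_enum _).
rewrite psumr_eq0 => [/allP Z1|k _]; last by rewrite mulrC mul_conjC_ge0.
by have:= Z1 j (mem_index_enum _); rewrite mulrC mul_conjC_eq0 mxE => /eqP.
Qed.

Lemma ip_mull m n p (A : 'M[C]_(m, p)) Z (W : 'M[C]_(p, n)) :
  ip Z (A *m W) = ip (A^t* *m Z) W.
Proof. by rewrite /ip ctrM trmxCK mulmxA. Qed.

Lemma ip_mulr m n p (A : 'M[C]_(p, n)) Z (W : 'M[C]_(m, p)) :
  ip Z (W *m A) = ip (Z *m A^t*) W.
Proof. by rewrite /ip ctrM trmxCK mulmxA mxtrace_mulC mulmxA. Qed.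

Lemma ip_cols m n (Z W : 'M[C]_(m, n)) :
  ip Z W = \sum_k ip (col k Z) (col k W).
Proof.
rewrite ipE; apply: eq_bigr => i _; rewrite ipE big_ord1.
by apply: eq_bigr => j _; rewrite !mxE.
Qed.

Lemma ip_tr m n (Z W : 'M[C]_(m, n)) : ip Z^T W^T = ip Z W.
Proof.
rewrite !ipE exchange_big; apply: eq_bigr => i _; apply: eq_bigr => j _.
by rewrite !mxE.
Qed.

Lemma ip00 m (Z W : 'cV[C]_m) : ip Z W = (Z^t* *m W) 0 0.
Proof. by rewrite /ip /mxtrace big_ord1. Qed.

Lemma ip_row m n p (Z Z' : 'M[C]_(m, n)) (W W' : 'M[C]_(m, p)) :
  ip (row_mx Z W) (row_mx Z' W') = ip Z Z' + ip W W'.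
Proof.
rewrite !ipE big_split_ord; congr (_ + _); apply: eq_bigr => i _;
  by apply: eq_bigr => j _; rewrite ?row_mxEl ?row_mxEr.
Qed.

Lemma ip_col m n p (Z Z' : 'M[C]_(n, m)) (W W' : 'M[C]_(p, m)) :
  ip (col_mx Z W) (col_mx Z' W') = ip Z Z' + ip W W'.
Proof. by rewrite -ip_tr !tr_col_mx ip_row !ip_tr. Qed.

Lemma ip_sqD m n (Z W : 'M[C]_(m, n)) :
  ip (Z + W) (Z + W) <= 2 * ip Z Z + 2 * ip W W.
Proof.
rewrite -subr_ge0; have := ip_ge0 (Z - W); rewrite !ip_lin.
by congr (0 <= _); ring.
Qed.

(** Iterating [ip_sqD] stands in for Cauchy-Schwarz. The exponential constant is harmless, since
    only some bound independent of the vectors is needed later. *)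
Lemma ip_sqsum m n I (r : seq I) (F : I -> 'M[C]_(m, n)) :
  ip (\sum_(i <- r) F i) (\sum_(i <- r) F i)
    <= 2 ^+ size r * \sum_(i <- r) ip (F i) (F i).
Proof.
elim: r => [|x r IH]; first by rewrite !big_nil mulr0 -(scale0r 0) ipZr mul0r.
rewrite !big_cons; apply: (le_trans (ip_sqD _ _)); rewrite exprS mulrDr lerD //.
  rewrite -mulrA ler_pM2l ?ltr0n // ler_peMl ?ip_ge0 //.
  by rewrite exprn_ege1 // ler1n.
by rewrite -mulrA ler_pM2l ?ltr0n.
Qed.

(** A substitute for Cauchy-Schwarz without square roots: for the moduli [a], [b] of two entries,
    [a^2 + b^2 - a b = (a - b)^2 + a b >= 0]. *)
Lemma ip_norm_le m n (Z W : 'M[C]_(m, n)) : `|ip Z W| <= ip Z Z + ip W W.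
Proof.
rewrite !ipE -big_split; apply: (le_trans (ler_norm_sum _ _ _)).
apply: ler_sum => i _; rewrite -big_split; apply: (le_trans (ler_norm_sum _ _ _)).
apply: ler_sum => j _ /=; rewrite normrM norm_conjC ![_^* * _]mulrC -!normCK.
set a := `|_|; set b := `|_|.
have a0 : 0 <= a by exact: normr_ge0.
have b0 : 0 <= b by exact: normr_ge0.
have: 0 <= (a - b) ^+ 2 by rewrite real_exprn_even_ge0 // rpredB ?ger0_real.
have ab0 : 0 <= a * b by exact: mulr_ge0.
move=> h; rewrite -subr_ge0; have := addr_ge0 h ab0; congr (0 <= _); ring.
Qed.

(** A bound for the squared operator norm of [M], got by expanding [M *m v] along the columns of [M]
    and applying [ip_sqsum]. *)
Definition mxbound m n (M : 'M[C]_(m, n)) : C :=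
  2 ^+ n * \sum_k ip (col k M) (col k M).

Lemma mxbound_ge0 m n (M : 'M[C]_(m, n)) : 0 <= mxbound M.
Proof. by rewrite mulr_ge0 ?exprn_ge0 // sumr_ge0 // => k _; exact: ip_ge0. Qed.

Lemma mxboundP m n p (M : 'M[C]_(m, n)) (Z : 'M[C]_(n, p)) :
  ip (M *m Z) (M *m Z) <= mxbound M * ip Z Z.
Proof.
rewrite !(ip_cols (M *m Z)) (ip_cols Z) mulr_sumr.
apply: ler_sum => k _; rewrite !colE -mulmxA -colE; set v := col k Z.
have -> : M *m v = \sum_i v i 0 *: col i M.
  apply/matrixP=> a b; rewrite !mxE summxE; apply: eq_bigr => i _.
  by rewrite (ord1 b) !mxE mulrC.
apply: (le_trans (ip_sqsum _ _)).
have -> : size (index_enum 'I_n) = n by rewrite -[index_enum _]enumT size_enum_ord.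
rewrite -mulrA ler_pM2l ?exprn_gt0 ?ltr0n //.
rewrite mulr_suml; apply: ler_sum => i _; rewrite ipZr ipZl mulrA -normCK mulrC.
rewrite ler_wpM2l ?ip_ge0 // ipE big_ord1 (bigD1 i) //= [_^* * _]mulrC -normCK.
by rewrite lerDl sumr_ge0 // => j _; rewrite mulrC mul_conjC_ge0.
Qed.

End InnerProduct.

(** * Identifying C^m (x) C^n with m x n matrices *)

Section Vectorization.
Variable C : numClosedFieldType.

Definition vecz m n (Z : 'M[C]_(m, n)) : 'cV[C]_(m * n) :=
  \col_i Z (mxtens_unindex i).1 (mxtens_unindex i).2.

Lemma vecz_surj m n (v : 'cV[C]_(m * n)) : exists Z : 'M[C]_(m, n), v = vecz Z.
Proof.
exists (\matrix_(i, j) v (mxtens_index (i, j)) 0).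
apply/matrixP=> i j; rewrite !mxE (ord1 j).
by rewrite -surjective_pairing mxtens_unindexK.
Qed.

Lemma vecz_sum m n (F : 'I_m -> 'I_n -> C) :
  \sum_(k < m * n) F (mxtens_unindex k).1 (mxtens_unindex k).2
    = \sum_i \sum_j F i j.
Proof.
rewrite pair_big /= (reindex (@mxtens_unindex m n)) //=.
by exists (@mxtens_index m n) => k _; rewrite (mxtens_indexK, mxtens_unindexK).
Qed.

Lemma vecz_inj m n : injective (@vecz m n).
Proof.
move=> Z W /matrixP ZW; apply/matrixP=> i j.
by have:= ZW (mxtens_index (i, j)) 0; rewrite !mxE mxtens_indexK.
Qed.

Lemma veczD m n (Z W : 'M[C]_(m, n)) : vecz (Z + W) = vecz Z + vecz W.
Proof. by apply/matrixP=> i j; rewrite !mxE. Qed.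

Lemma veczN m n (Z : 'M[C]_(m, n)) : vecz (- Z) = - vecz Z.
Proof. by apply/matrixP=> i j; rewrite !mxE. Qed.

Lemma vecz0 m n : vecz (0 : 'M[C]_(m, n)) = 0.
Proof. by apply/matrixP=> i j; rewrite !mxE. Qed.

Lemma ip_vecz m n (Z W : 'M[C]_(m, n)) : ip (vecz Z) (vecz W) = ip Z W.
Proof.
rewrite !ipE big_ord1 exchange_big /= -(vecz_sum (fun i j => (Z i j)^* * W i j)).
by apply: eq_bigr => k _; rewrite !mxE.
Qed.

(** Replaces Kronecker products by two-sided multiplication. [X] acts on the second index of [Z], so
    it appears on the right and transposed. *)
Lemma tens_vecz m n p q (A : 'M[C]_(m, p)) (X : 'M[C]_(n, q)) (Z : 'M[C]_(p, q)) :
  (A *t X) *m vecz Z = vecz (A *m Z *m X^T).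
Proof.
apply/matrixP=> i j; rewrite !mxE.
under eq_bigr do rewrite !mxE.
set i1 := (mxtens_unindex i).1; set i2 := (mxtens_unindex i).2.
rewrite (vecz_sum (fun k l => A i1 k * X i2 l * Z k l)) exchange_big /=.
apply: eq_bigr => l _; rewrite !mxE mulr_suml.
by apply: eq_bigr => k _; rewrite mulrAC.
Qed.

(** The columns of [cokermx A] are killed by [A], so injectivity forces the cokernel matrix to
    vanish. *)
Lemma unitmx_inj n (A : 'M[C]_n) :
  (forall v : 'cV_n, A *m v = 0 -> v = 0) -> A \in unitmx.
Proof.
move=> Ainj; rewrite -row_full_unit -cokermx_eq0; apply/eqP/matrixP=> i j.
have := Ainj (col j (cokermx A)); rewrite colE mulmxA mulmx_coker mul0mx.
by rewrite -colE => /(_ erefl)/matrixP/(_ i 0); rewrite !mxE.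
Qed.

End Vectorization.

(** * The pencil as a Hermitian operator, and the realization through its solutions *)

Section Pencil.
Variables (C : numClosedFieldType) (g d : nat).
Variables (K : 'M[C]_d) (B : 'I_g -> 'M[C]_d) (c : 'cV[C]_d).

(* The action of Lambda_B(X) + Lambda_B(X)^* on C^d (x) C^n = 'M_(d, n). *)
Definition lam n (X : 'I_g -> 'M[C]_n) (Z : 'M[C]_(d, n)) : 'M[C]_(d, n) :=
  \sum_j (B j *m Z *m (X j)^T + adjt B j *m Z *m (adjt X j)^T).

Lemma lamD n (X : 'I_g -> 'M[C]_n) Z W : lam X (Z + W) = lam X Z + lam X W.
Proof.
rewrite -big_split; apply: eq_bigr => j _.
by rewrite !mulmxDr !mulmxDl addrACA.
Qed.

Lemma lamZ n (X : 'I_g -> 'M[C]_n) a Z : lam X (a *: Z) = a *: lam X Z.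
Proof.
rewrite scaler_sumr; apply: eq_bigr => j _.
by rewrite scalerDr -!scalemxAr -!scalemxAl.
Qed.

Lemma lam_add n (X Y : 'I_g -> 'M[C]_n) Z :
  lam (fun j => X j + Y j) Z = lam X Z + lam Y Z.
Proof.
rewrite -big_split; apply: eq_bigr => j _; rewrite /adjt ctrD.
by rewrite !linearD addrACA.
Qed.

Lemma lam_scale n (s : C) (X : 'I_g -> 'M[C]_n) Z : s \is Num.real ->
  lam (fun j => s *: X j) Z = s *: lam X Z.
Proof.
move=> sR; rewrite scaler_sumr; apply: eq_bigr => j _.
by rewrite /adjt ctrZ (CrealP sR) !linearZ scalerDr.
Qed.

(** Passing to the adjoint exchanges the two summands of each index [j]. *)
Lemma lam_herm n (X : 'I_g -> 'M[C]_n) Z W : ip Z (lam X W) = ip (lam X Z) W.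
Proof.
rewrite ip_sumr ip_suml; apply: eq_bigr => j _.
have ip_conj_mx (A : 'M[C]_d) (Y : 'M[C]_n) :
    ip Z (A *m W *m Y^T) = ip (A^t* *m Z *m (Y^t*)^T) W.
  by rewrite ip_mulr ip_mull mulmxA map_trmx.
by rewrite ipDr ipDl !ip_conj_mx /adjt !trmxCK addrC.
Qed.

Lemma pencil_vecz n (X : 'I_g -> 'M[C]_n) Z :
  pencil K B X *m vecz Z = vecz (K *m Z - lam X Z).
Proof.
rewrite /pencil !mulmxBl tens_vecz trmx1 mulmx1 veczD veczN -addrA; congr (_ + _).
rewrite -opprD; congr (- _); rewrite -mulmxDl /Lambda -big_split mulmx_suml.
rewrite /lam (big_morph _ (@veczD C d n) (@vecz0 C d n)).
by apply: eq_bigr => j _; rewrite mulmxDl !tens_vecz veczD.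
Qed.

Lemma in_domainP n (X : 'I_g -> 'M[C]_n) :
  (forall Z, K *m Z = lam X Z -> Z = 0) -> in_domain K B X.
Proof.
move=> inj; apply: unitmx_inj => v; have [Z ->] := vecz_surj v.
rewrite pencil_vecz -[RHS]vecz0 => /vecz_inj/eqP.
by rewrite subr_eq0 => /eqP/inj ->; rewrite vecz0.
Qed.

Lemma resolvent_ex n (X : 'I_g -> 'M[C]_n) (W : 'M[C]_(d, n)) :
  in_domain K B X -> exists Z, K *m Z - lam X Z = W.
Proof.
move=> domX; have [Z ZE] := vecz_surj (invmx (pencil K B X) *m vecz W).
by exists Z; apply: vecz_inj; rewrite -pencil_vecz -ZE mulKVmx.
Qed.

Lemma pencil_herm n (X : 'I_g -> 'M[C]_n) :
  K^t* = K -> (pencil K B X)^t* = pencil K B X.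
Proof.
move=> KH; rewrite /pencil /Lambda -!addrA -!opprD -!big_split !(linearB, linearD) /=.
rewrite map_mxB trmx_tens map_mxT KH trmx1 map_mx1; congr (_ - _).
rewrite linear_sum map_mx_sum; apply: eq_bigr => j _ /=.
by rewrite linearD map_mxD /= !trmx_tens !map_mxT /adjt !trmxCK addrC.
Qed.

Lemma realization_herm n (X : 'I_g -> 'M[C]_n) : K^t* = K ->
  (realization K B c X)^t* = realization K B c X.
Proof.
move=> KH; rewrite /realization !ctrM trmxCK mulmxA; congr (_ *m _ *m _).
by rewrite trmx_inv map_invmx -/(_^t*) pencil_herm.
Qed.

(** Trades the inverse of the pencil for a solution [Z] of the linear equation with right side
    [c *m w], so that convexity becomes a statement about such solutions. *)
Lemma realization_ip n (X : 'I_g -> 'M[C]_n) (w : 'rV[C]_n) Z :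
  in_domain K B X -> K *m Z - lam X Z = c *m w ->
  ((vecz w)^t* *m realization K B c X *m vecz w) 0 0 = ip (c *m w) Z.
Proof.
move=> domX ZE.
have cw : (c *t 1%:M) *m vecz w = vecz (c *m w) by rewrite tens_vecz trmx1 mulmx1.
rewrite /realization !mulmxA -ctrM cw -mulmxA cw -mulmxA -ip00 -ZE -pencil_vecz.
by rewrite mulKmx // pencil_vecz ip_vecz.
Qed.

End Pencil.

(** * Operator-norm balls of matrix tuples *)

Section Balls.
Variables (C : numClosedFieldType) (g : nat).

(** The column with entries [X j] has operator norm squared at most [r]. Using the squared radius
    avoids square roots. *)
Definition opball n (r : C) (X : 'I_g -> 'M[C]_n) : Prop :=
  forall v : 'cV[C]_n, \sum_j ip (X j *m v) (X j *m v) <= r * ip v v.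

Lemma opball_mx n r (X : 'I_g -> 'M[C]_n) p (Z : 'M[C]_(n, p)) : opball r X ->
  \sum_j ip (X j *m Z) (X j *m Z) <= r * ip Z Z.
Proof.
move=> Xr; rewrite (ip_cols Z) mulr_sumr.
rewrite (eq_bigr (fun j => \sum_k ip (X j *m col k Z) (X j *m col k Z))).
  by rewrite exchange_big; apply: ler_sum => k _; exact: Xr.
move=> j _; rewrite ip_cols; apply: eq_bigr => k _.
by rewrite !colE !mulmxA.
Qed.

Lemma opball_comp n r (X : 'I_g -> 'M[C]_n) p (Z : 'M[C]_(n, p)) j : opball r X ->
  ip (X j *m Z) (X j *m Z) <= r * ip Z Z.
Proof.
move=> Xr; apply: le_trans (opball_mx Z Xr); rewrite (bigD1 j) //= lerDl.
by apply: sumr_ge0 => i _; exact: ip_ge0.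
Qed.

(** An operator and its adjoint have the same norm. With [Y = adjt X j *m Z], expand the square of
    [r *: Z - X j *m Y] and add [r |Y|^2 - |X j Y|^2 >= 0]; what remains is [r] times the claim. *)
Lemma opball_adj n r (X : 'I_g -> 'M[C]_n) p (Z : 'M[C]_(n, p)) j :
  0 < r -> opball r X -> ip (adjt X j *m Z) (adjt X j *m Z) <= r * ip Z Z.
Proof.
move=> r0 Xr; set Y := adjt X j *m Z.
have XYZ : ip Z (X j *m Y) = ip Y Y by rewrite ip_mull.
have XYZ' : ip (X j *m Y) Z = ip Y Y by rewrite -ip_conj XYZ ip_conj.
have rr : r^* = r by apply/CrealP; exact: gtr0_real.
rewrite -(ler_pM2l r0) -subr_ge0.
have XY_le : 0 <= r * ip Y Y - ip (X j *m Y) (X j *m Y).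
  by rewrite subr_ge0 opball_comp.
have := addr_ge0 (ip_ge0 (r *: Z - X j *m Y)) XY_le.
by rewrite !ip_lin !ipZr !ipZl rr XYZ XYZ'; congr (0 <= _); ring.
Qed.

Lemma free_ball_form n (eps : C) (X : 'I_g -> 'M[C]_n) (v : 'cV_n) :
  (v^t* *m ((eps ^+ 2)%:M - \sum_(j < g) (X j)^t* *m X j) *m v) 0 0
    = eps ^+ 2 * ip v v - \sum_j ip (X j *m v) (X j *m v).
Proof.
rewrite -mulmxA -ip00 mulmxBl !ip_lin mul_scalar_mx ipZr; congr (_ - _).
rewrite mulmx_suml ip_sumr; apply: eq_bigr => j _.
by rewrite -mulmxA [LHS]ip_mull trmxCK.
Qed.

Lemma free_ball_opball n (eps : C) (X : 'I_g -> 'M[C]_n) :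
  free_ball eps X -> opball (eps ^+ 2) X.
Proof.
move=> [_ Xpos] v; have [->|/Xpos] := eqVneq v 0.
  rewrite big1 => [|j _]; first by rewrite /ip mulmx0 mxtrace0 mulr0.
  by rewrite /ip !mulmx0 mxtrace0.
by rewrite free_ball_form subr_gt0 => /ltW.
Qed.

Lemma opball_free_ball n (eps r : C) (X : 'I_g -> 'M[C]_n) :
  0 < eps -> r < eps ^+ 2 -> opball r X -> free_ball eps X.
Proof.
move=> eps0 reps Xr; split=> [|v v0].
  have e2 : (eps ^+ 2)^* = eps ^+ 2 by apply/CrealP/gtr0_real; rewrite exprn_gt0.
  apply/herm_adj; rewrite linearB /= map_mxB tr_scalar_mx map_scalar_mx /= e2.
  congr (_ - _); rewrite linear_sum map_mx_sum; apply: eq_bigr => j _ /=.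
  by rewrite ctrM trmxCK.
have v0' : 0 < ip v v.
  by rewrite lt_def ip_ge0 andbT; apply: contra_neq v0 => ve; apply: ip_le0; rewrite ve.
by rewrite free_ball_form subr_gt0 (le_lt_trans (Xr v)) // ltr_pM2r.
Qed.

Lemma opball_bounded n (X : 'I_g -> 'M[C]_n) : exists2 h, 0 <= h & opball h X.
Proof.
exists (\sum_j mxbound (X j)).
  by apply: sumr_ge0 => j _; exact: mxbound_ge0.
by move=> v; rewrite mulr_suml; apply: ler_sum => j _; exact: mxboundP.
Qed.

(** For a sign [e], nonnegativity of [s |x - e h|^2] gives [|x + e s h|^2 <= (1 + s) |x|^2 + (s +
    s^2) |h|^2]; this is summed over [j]. *)
Lemma opball_perturb n (X H : 'I_g -> 'M[C]_n) (r h s : C) :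
  0 <= s -> opball r X -> opball h H ->
  opball ((1 + s) * r + (s + s ^+ 2) * h) (fun j => X j + s *: H j)
  /\ opball ((1 + s) * r + (s + s ^+ 2) * h) (fun j => X j + (- s) *: H j).
Proof.
move=> s0 Xr Hh.
have sE : s^* = s by apply/CrealP; exact: ger0_real.
have main (e : C) : e * e = 1 -> e^* = e ->
    opball ((1 + s) * r + (s + s ^+ 2) * h) (fun j => X j + (e * s) *: H j).
  move=> ee eE v; set T := _ * ip v v.
  apply: (@le_trans _ _ ((1 + s) * (\sum_j ip (X j *m v) (X j *m v))
            + (s + s ^+ 2) * (\sum_j ip (H j *m v) (H j *m v)))); last first.
    rewrite /T [X in _ <= X]mulrDl -!mulrA lerD // ler_wpM2l ?Xr ?Hh //.
      by rewrite addr_ge0.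
    by rewrite addr_ge0 ?exprn_ge0.
  rewrite !mulr_sumr -big_split; apply: ler_sum => j _ /=.
  rewrite mulmxDl -scalemxAl -subr_ge0.
  have := mulr_ge0 s0 (ip_ge0 (X j *m v - e *: (H j *m v))).
  rewrite !ip_lin !ipZr !ipZl rmorphM /= eE sE.
  have es T' : e * s * (e * s * T') = s * s * T' by rewrite -[RHS]mul1r -ee; ring.
  by rewrite es [e * (e * _)]mulrA ee; congr (0 <= _); ring.
split.
  have /= := main 1 (mulr1 1) (rmorph1 _); congr opball.
  by apply: boolp.funext => j; rewrite mul1r.
have /= := main (-1); rewrite mulrNN mulr1 rmorphN rmorph1 => /(_ erefl erefl).
by congr opball; apply: boolp.funext => j; rewrite mulN1r.
Qed.

End Balls.

(** * Small tuples: invertibility of the pencil and bounds on its inverse *)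

Section Contraction.
Variables (C : numClosedFieldType) (g d : nat).
Variables (K : 'M[C]_d) (B : 'I_g -> 'M[C]_d).
Hypothesis Ksig : signature_mx K.

Definition lam_bound : C := 2 ^+ size (index_enum 'I_g) *
  \sum_j (2 * mxbound (B j) + 2 * mxbound (adjt B j)).

Lemma lam_bound_ge0 : 0 <= lam_bound.
Proof.
rewrite mulr_ge0 ?exprn_ge0 // sumr_ge0 // => j _.
by rewrite addr_ge0 // mulr_ge0 // mxbound_ge0.
Qed.

Lemma lam_boundP n (X : 'I_g -> 'M[C]_n) r Z : 0 < r -> opball r X ->
  ip (lam B X Z) (lam B X Z) <= lam_bound * r * ip Z Z.
Proof.
move=> r0 Xr; apply: (le_trans (ip_sqsum _ _)).
rewrite /lam_bound -(mulrA _ r) -(mulrA (2 ^+ _)) ler_pM2l ?exprn_gt0 // mulr_suml.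
apply: ler_sum => j _; apply: (le_trans (ip_sqD _ _)).
rewrite [X in _ <= X]mulrDl -!(mulrA 2) lerD // ler_pM2l // -!mulmxA.
  apply: (le_trans (mxboundP _ _)); rewrite ler_wpM2l ?mxbound_ge0 //.
  by rewrite -ip_tr trmx_mul trmxK -(ip_tr Z) opball_comp.
apply: (le_trans (mxboundP _ _)); rewrite ler_wpM2l ?mxbound_ge0 //.
by rewrite -ip_tr trmx_mul trmxK -(ip_tr Z) opball_adj.
Qed.

(** The operator norm of [lam B X] is at most 1/2. As [K] is an isometry, this margin makes
    [K - lam B X] injective with inverse of norm at most 2. *)
Definition contraction n (X : 'I_g -> 'M[C]_n) : Prop :=
  forall Z : 'M[C]_(d, n), 4 * ip (lam B X Z) (lam B X Z) <= ip Z Z.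

Lemma opball_contraction n (X : 'I_g -> 'M[C]_n) r : 0 < r ->
  4 * lam_bound * r <= 1 -> opball r X -> contraction X.
Proof.
move=> r0 rs Xr Z; rewrite -[X in _ <= X]mul1r.
apply: le_trans (ler_wpM2r (ip_ge0 Z) rs).
by rewrite -(mulrA 4 lam_bound) -(mulrA 4) ler_pM2l // lam_boundP.
Qed.

Lemma ip_sig n (Z : 'M[C]_(d, n)) : ip (K *m Z) (K *m Z) = ip Z Z.
Proof.
have [/herm_adj KH KK] := Ksig.
by rewrite ip_mull KH mulmxA KK mul1mx.
Qed.

Lemma contraction_domain n (X : 'I_g -> 'M[C]_n) :
  contraction X -> in_domain K B X.
Proof.
move=> Xc; apply: in_domainP => Z ZE; apply: ip_le0.
have := Xc Z; rewrite -ZE ip_sig -subr_ge0 => Z0.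
rewrite -[_ <= _](ler_pM2l (_ : 0 < 3)) ?ltr0n // mulr0 -subr_ge0 sub0r.
by move: Z0; congr (0 <= _); ring.
Qed.

(** [|W|^2 = |K W|^2 <= 2 |q|^2 + 2 |lam B X W|^2 <= 2 |q|^2 + |W|^2 / 2]. The bound does not depend
    on [X]. *)
Lemma contraction_bound n (X : 'I_g -> 'M[C]_n) W q :
  contraction X -> K *m W - lam B X W = q -> ip W W <= 4 * ip q q.
Proof.
move=> Xc qE; have KW : K *m W = q + lam B X W by rewrite -qE subrK.
have := ip_sqD q (lam B X W); rewrite -KW ip_sig => h.
rewrite -subr_ge0 in h; have := Xc W; rewrite -subr_ge0.
move=> /(addr_ge0 (mulr_ge0 (ler0n _ 2) h)).
rewrite -[X in _ -> is_true X]subr_ge0.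
by congr (0 <= _); ring.
Qed.

Lemma contraction_le1 n (X : 'I_g -> 'M[C]_n) Z :
  contraction X -> ip Z (lam B X Z) <= ip Z Z.
Proof.
move=> Xc; rewrite -(ler_pM2l (_ : 0 < 2)) ?ltr0n // -subr_ge0.
have h : ip (lam B X Z) (lam B X Z) <= ip Z Z.
  by apply: le_trans (Xc Z); rewrite ler_peMl ?ip_ge0 // ler1n.
have := ip_ge0 (Z - lam B X Z); rewrite -subr_ge0 in h.
rewrite !ip_lin -[ip (lam B X Z) Z]lam_herm => /addr_ge0 /(_ h).
by congr (0 <= _); ring.
Qed.

End Contraction.

(** * The equation at two points and at their midpoint *)

Section Resolvent.
Variables (C : numClosedFieldType) (g d : nat).
Variables (K : 'M[C]_d) (B : 'I_g -> 'M[C]_d) (c : 'cV[C]_d).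
Hypothesis Ksig : signature_mx K.

Definition pen n (X : 'I_g -> 'M[C]_n) (Z : 'M[C]_(d, n)) := K *m Z - lam B X Z.

Lemma penD n (X : 'I_g -> 'M[C]_n) Z W : pen X (Z + W) = pen X Z + pen X W.
Proof. by rewrite /pen mulmxDr lamD opprD addrACA. Qed.

Lemma penZ n (X : 'I_g -> 'M[C]_n) a Z : pen X (a *: Z) = a *: pen X Z.
Proof. by rewrite /pen -scalemxAr lamZ scalerBr. Qed.

Lemma penB n (X : 'I_g -> 'M[C]_n) Z W : pen X (Z - W) = pen X Z - pen X W.
Proof. by rewrite penD -scaleN1r penZ scaleN1r. Qed.

Lemma pen_herm n (X : 'I_g -> 'M[C]_n) Z W : ip Z (pen X W) = ip (pen X Z) W.
Proof.
have [/herm_adj KH _] := Ksig.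
by rewrite /pen ipDr ipNr ipDl ipNl lam_herm ip_mull KH.
Qed.

Lemma lam_midpoint n (X Y : 'I_g -> 'M[C]_n) Z :
  lam B (midpoint X Y) Z = 2^-1 *: (lam B X Z + lam B Y Z).
Proof.
by rewrite /midpoint lam_scale ?lam_add // realV realn.
Qed.

Lemma contraction_midpoint n (X Y : 'I_g -> 'M[C]_n) :
  contraction B X -> contraction B Y -> contraction B (midpoint X Y).
Proof.
move=> Xc Yc Z; rewrite lam_midpoint.
have := Yc Z; have := Xc Z; have := ip_sqD (lam B X Z) (lam B Y Z).
have two_real : (2^-1 : C)^* = 2^-1 by apply/CrealP; rewrite realV realn.
rewrite ipZr ipZl two_real; set a := ip _ _; set b := ip _ _; set e := ip _ _.
move=> abe aZ bZ.
have -> : 4 * (2^-1 * (2^-1 * a)) = a by field.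
apply: (le_trans abe).
rewrite -(ler_pM2l (_ : 0 < 2)) ?ltr0n //.
have := lerD aZ bZ; congr (_ <= _); ring.
Qed.

Lemma realization_midpoint_form n (X Y : 'I_g -> 'M[C]_n) (w : 'rV[C]_n) Zx Zy Zm :
  in_domain K B X -> in_domain K B Y -> in_domain K B (midpoint X Y) ->
  pen X Zx = c *m w -> pen Y Zy = c *m w -> pen (midpoint X Y) Zm = c *m w ->
  ((vecz w)^t* *m (2^-1 *: (realization K B c X + realization K B c Y)
     - realization K B c (midpoint X Y)) *m vecz w) 0 0
  = 2^-1 * (ip (c *m w) Zx + ip (c *m w) Zy) - ip (c *m w) Zm.
Proof.
move=> dX dY dM EX EY EM.
rewrite -(realization_ip dX EX) -(realization_ip dY EY) -(realization_ip dM EM).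
rewrite mulmxBr -scalemxAr mulmxDr mulmxBl -scalemxAl mulmxDl.
by rewrite [LHS]mxE [X in X + _ = _]mxE [X in _ * X + _ = _]mxE [X in _ + X = _]mxE.
Qed.

Lemma pen_midpoint n (X Y : 'I_g -> 'M[C]_n) Z :
  pen X Z + pen Y Z = 2 *: pen (midpoint X Y) Z.
Proof.
rewrite /pen addrACA -opprD lam_midpoint scalerBr scalerA divff ?pnatr_eq0 //.
by rewrite scale1r scaler_nat mulr2n.
Qed.

(* With [W] the solution at the midpoint, the gap in the convexity inequality is
   the sum of the values of the pencil's quadratic form at the two increments. *)
Lemma convexity_gap n (X Y : 'I_g -> 'M[C]_n) (Zx Zy W V : 'M[C]_(d, n)) :
  pen X Zx = V -> pen Y Zy = V -> pen (midpoint X Y) W = V ->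
  ip (W - Zx) (pen X (W - Zx)) + ip (W - Zy) (pen Y (W - Zy))
    = ip V Zx + ip V Zy - 2 * ip V W.
Proof.
move=> EX EY EM.
have gap1 (X' : 'I_g -> 'M[C]_n) Z : pen X' Z = V ->
    ip (W - Z) (pen X' (W - Z))
      = ip W (pen X' W) - ip W V - ip V W + ip V Z.
  move=> E; have ZV : ip Z V = ip V Z by rewrite -{1}E pen_herm E.
  have := pen_herm X' Z W; rewrite penB E; move: (pen X' W) => P ZP.
  by rewrite !ip_lin ZP ZV; ring.
rewrite !gap1 //.
(* The pencil is affine in [X], so its values at [X] and [Y] add up to twice the midpoint value,
   where [W] is an exact solution. *)
have := congr1 (ip W) (pen_midpoint X Y W); rewrite ipDr ipZr EM => h.
transitivity (ip W (pen X W) + ip W (pen Y W) - 2 * ip W V - 2 * ip V W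
              + ip V Zx + ip V Zy); first ring.
by rewrite h; ring.
Qed.

End Resolvent.

(** * Positivity of QKQ implies convexity near 0 *)

Section RangeProjection.
Variables (C : numClosedFieldType) (g d : nat).
Variables (K : 'M[C]_d) (B : 'I_g -> 'M[C]_d).
Let Q := orthproj (rng B + rng (adjt B))%MS.

Lemma orthproj_fix m p (U : 'M[C]_(m, d)) (A : 'M[C]_(d, p)) :
  (A^T <= U)%MS -> orthproj U *m A = A.
Proof.
have [_ QQ QU] := orthprojP U; rewrite -QU => /submxP[D /(congr1 trmx)].
by rewrite trmxK trmx_mul trmxK => ->; rewrite mulmxA QQ.
Qed.

Lemma orthproj_adj m (U : 'M[C]_(m, d)) : (orthproj U)^t* = orthproj U.
Proof. by have [/herm_adj] := orthprojP U. Qed.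

Lemma rng_projl j : Q *m B j = B j.
Proof.
apply: orthproj_fix; apply: submx_trans (addsmxSl _ _).
by rewrite /rng (sumsmx_sup j).
Qed.

Lemma rng_projr j : Q *m adjt B j = adjt B j.
Proof.
apply: orthproj_fix; apply: submx_trans (addsmxSr _ _).
by rewrite /rng (sumsmx_sup j).
Qed.

Lemma lam_projl n (X : 'I_g -> 'M[C]_n) Z : Q *m lam B X Z = lam B X Z.
Proof.
rewrite mulmx_sumr; apply: eq_bigr => j _.
by rewrite mulmxDr !mulmxA rng_projl rng_projr.
Qed.

(** [Q] fixes the ranges of both [B j] and [adjt B j]; taking adjoints, each of them also absorbs
    [Q] on the right. *)
Lemma lam_projr n (X : 'I_g -> 'M[C]_n) Z : lam B X (Q *m Z) = lam B X Z.
Proof.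
apply: eq_bigr => j _; rewrite !mulmxA.
rewrite -{1}[B j]trmxCK -{1}[Q]orthproj_adj -ctrM rng_projr trmxCK.
by rewrite -[Q]orthproj_adj -ctrM rng_projl.
Qed.

Lemma psd_ip n (P : 'M[C]_d) (Z : 'M[C]_(d, n)) :
  possemidef P -> 0 <= ip Z (P *m Z).
Proof.
move=> [_ Ppos]; rewrite ip_cols; apply: sumr_ge0 => k _.
have -> : col k (P *m Z) = P *m col k Z by rewrite !colE mulmxA.
by rewrite ip00 mulmxA.
Qed.

Hypothesis Ksig : signature_mx K.

Lemma sig_ip_le n (Z : 'M[C]_(d, n)) : ip Z (K *m Z) <= ip Z Z.
Proof.
have [/herm_adj KH _] := Ksig.
rewrite ip_mull KH -(ler_pM2l (_ : 0 < 2)) ?ltr0n // -subr_ge0.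
have := ip_ge0 (Z - K *m Z); rewrite !ip_lin ip_sig // [ip Z (K *m Z)]ip_mull KH.
by congr (0 <= _); ring.
Qed.

Lemma pen_ge0_compression n (X : 'I_g -> 'M[C]_n) D :
  possemidef (Q *m K *m Q) -> contraction B X -> Q *m (K *m D) = K *m D ->
  0 <= ip D (pen K B X D).
Proof.
move=> Ppos Xc QU; have [/herm_adj KH KK] := Ksig.
have [_ QQ _] := orthprojP (rng B + rng (adjt B))%MS; rewrite -/Q in QQ.
have QH : Q^t* = Q by exact: orthproj_adj.
set P := Q *m K *m Q; have PH : P^t* = P by rewrite !ctrM QH KH mulmxA.
set U := K *m D; set V := P *m U.
have DE : D = K *m U by rewrite mulmxA KK mul1mx.
have VE : V = Q *m D by rewrite /V /P -mulmxA QU -mulmxA -DE.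
have QV : Q *m V = V by rewrite VE mulmxA QQ.
have DU : ip D U = ip U V.
  by rewrite VE [RHS]ip_mull QH QU {1}/U ip_mull KH.
have DA : ip D (lam B X D) <= ip V V.
  apply: le_trans (contraction_le1 V Xc).
  by rewrite -lam_projr -lam_projl ip_mull QH -VE.
have PV : ip V (P *m V) <= ip V V.
  by rewrite -!mulmxA QV ip_mull QH QV sig_ip_le.
have UPV : ip U (P *m V) = ip V V by rewrite ip_mull PH.
(* It remains to see [<U, PU> >= <PU, PU>]. Positivity of [P] at [U - PU] gives
   [<U, V> - 2 <V, V> + <V, PV> >= 0], and [PV] supplies [<V, PV> <= <V, V>]. *)
have := psd_ip (U - V) Ppos; rewrite mulmxBr -/P -/V !ip_lin UPV => h.
rewrite /pen -/U DU; rewrite -subr_ge0 in PV; rewrite -subr_ge0 in DA.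
by have := addr_ge0 DA (addr_ge0 PV h); congr (0 <= _); ring.
Qed.

Variable c : 'cV[C]_d.

Lemma psd_convex_form n (X Y : 'I_g -> 'M[C]_n) (w : 'rV[C]_n) :
  possemidef (Q *m K *m Q) -> contraction B X -> contraction B Y ->
  0 <= ((vecz w)^t* *m (2^-1 *: (realization K B c X + realization K B c Y)
     - realization K B c (midpoint X Y)) *m vecz w) 0 0.
Proof.
move=> Ppos Xc Yc; have Mc := contraction_midpoint Xc Yc.
have dX := contraction_domain Ksig Xc; have dY := contraction_domain Ksig Yc.
have dM := contraction_domain Ksig Mc.
have [Zx EX] := resolvent_ex (c *m w) dX.
have [Zy EY] := resolvent_ex (c *m w) dY.
have [W EM] := resolvent_ex (c *m w) dM.
rewrite (realization_midpoint_form dX dY dM EX EY EM).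
(* Both equations have the same right side, so [K] sends the increment to a difference of values of
   [lam], which [Q] fixes. *)
have incr (X' : 'I_g -> 'M[C]_n) Z : pen K B X' Z = c *m w ->
    Q *m (K *m (W - Z)) = K *m (W - Z).
  move=> E; suff -> : K *m (W - Z) = lam B (midpoint X Y) W - lam B X' Z.
    by rewrite mulmxBr !lam_projl.
  rewrite mulmxBr; move: EM; rewrite -E => /eqP.
  rewrite /pen subr_eq => /eqP ->.
  by rewrite -(addrA (K *m Z)) (addrC (K *m Z)) addrK addrC.
have := addr_ge0 (pen_ge0_compression Ppos Xc (incr _ _ EX))
                 (pen_ge0_compression Ppos Yc (incr _ _ EY)).
rewrite (convexity_gap Ksig EX EY EM) => gap.
rewrite -(pmulr_rge0 _ (_ : 0 < 2)) ?ltr0n //.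
by move: gap; congr (0 <= _); field.
Qed.

Lemma psd_convex_near_0 : possemidef (Q *m K *m Q) -> convex_near_0 K B c.
Proof.
move=> Ppos; have [/herm_adj KH _] := Ksig.
(* The radius will be [1/t]. This [t] satisfies [t^2 >= 4 * lam_bound B], which is what
   [opball_contraction] asks of the squared radius. *)
set t : C := 2 * (lam_bound B + 1).
have b0 := lam_bound_ge0 B.
have t0 : 0 < t by rewrite mulr_gt0 // ltr_wpDl.
have ball_contr n (X : 'I_g -> 'M[C]_n) : free_ball t^-1 X -> contraction B X.
  move=> /free_ball_opball; apply: opball_contraction.
    by rewrite exprn_gt0 // invr_gt0.
  rewrite exprVn ler_pdivrMr ?exprn_gt0 // mul1r -subr_ge0.
  have -> : t ^+ 2 - 4 * lam_bound B = 4 * (lam_bound B ^+ 2 + lam_bound B + 1).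
    by rewrite /t; ring.
  by rewrite mulr_ge0 // !addr_ge0 ?exprn_ge0.
exists t^-1; split=> [|n X /ball_contr|n X Y /ball_contr Xc /ball_contr Yc].
- by rewrite invr_gt0.
- exact: contraction_domain.
split.
  apply/herm_adj.
  have two_real : (2^-1 : C)^* = 2^-1 by apply/CrealP; rewrite realV realn.
  rewrite linearB /= map_mxB ctrZ two_real ctrD.
  by rewrite !realization_herm.
by move=> v; have [w ->] := vecz_surj v; exact: psd_convex_form.
Qed.

End RangeProjection.

(** * Direct sums, off-diagonal directions and open balls *)

Section Perturbation.
Variables (C : numClosedFieldType) (g d : nat).
Variables (K : 'M[C]_d) (B : 'I_g -> 'M[C]_d).

Definition dsum n m (X : 'I_g -> 'M[C]_n) (Y : 'I_g -> 'M[C]_m) :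
  'I_g -> 'M[C]_(n + m) := fun j => block_mx (X j) 0 0 (Y j).

(* Chosen so that the block of Lambda_B(H) + Lambda_B(H)^* from C^d (x) C^n to
   C^d (x) C sends Z to sum_j B_j Z a_j + adjt B j Z b_j. *)
Definition offdiag n (a b : 'I_g -> 'cV[C]_n) : 'I_g -> 'M[C]_(n + 1) :=
  fun j => block_mx 0 ((b j)^t*)^T (a j)^T 0.

Lemma lam_dsum n m (X : 'I_g -> 'M[C]_n) (Y : 'I_g -> 'M[C]_m) Z W :
  lam B (dsum X Y) (row_mx Z W) = row_mx (lam B X Z) (lam B Y W).
Proof.
transitivity (\sum_j row_mx (B j *m Z *m (X j)^T + adjt B j *m Z *m (adjt X j)^T)
                    (B j *m W *m (Y j)^T + adjt B j *m W *m (adjt Y j)^T)).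
  apply: eq_bigr => j _; rewrite /adjt /dsum !tr_block_mx !map_block_mx.
  rewrite !tr_block_mx !trmx0 !map_mx0 !trmx0 !mul_mx_row !mul_row_block.
  by rewrite !mulmx0 !addr0 !add0r add_row_mx.
by rewrite /lam; elim/big_rec3: _ => [|j x y z _ ->]; rewrite ?row_mx0 ?add_row_mx.
Qed.

Lemma lam0 n (W : 'M[C]_(d, n)) : lam B (fun=> 0) W = 0.
Proof.
apply: big1 => j _; rewrite /adjt !trmx0 map_mx0 trmx0.
by rewrite !mulmx0 addr0.
Qed.

Lemma lam_offdiag n (a b : 'I_g -> 'cV[C]_n) (Z : 'M[C]_(d, n)) :
  lam B (offdiag a b) (row_mx Z 0)
    = row_mx 0 (\sum_j (B j *m (Z *m a j) + adjt B j *m (Z *m b j))).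
Proof.
rewrite /lam.
transitivity (\sum_j row_mx (0 : 'M[C]_(d, n))
                       (B j *m (Z *m a j) + adjt B j *m (Z *m b j))).
  apply: eq_bigr => j _; rewrite /adjt /offdiag !tr_block_mx !map_block_mx.
  rewrite !tr_block_mx !trmxK !trmx0 !map_mx0 !trmx0 !mul_mx_row !mul_row_block.
  rewrite !mulmx0 !mul0mx !addr0 ?add0r add_row_mx addr0 !mulmxA.
  congr (row_mx _ (_ + _ *m _)).
  by apply/matrixP=> i k; rewrite !mxE conjCK.
by elim/big_rec2: _ => [|j x y _ ->]; rewrite ?row_mx0 ?add_row_mx ?addr0.
Qed.

Lemma opball_dsum n m r (X : 'I_g -> 'M[C]_n) (Y : 'I_g -> 'M[C]_m) :
  opball r X -> opball r Y -> opball r (dsum X Y).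
Proof.
move=> Xr Yr v; rewrite -[v]vsubmxK ip_col mulrDr.
have := lerD (Xr (usubmx v)) (Yr (dsubmx v)); rewrite -big_split; congr (_ <= _).
apply: eq_bigr => j _; rewrite mul_block_col !mul0mx addr0 add0r.
by rewrite ip_col.
Qed.

Lemma opball_le n r r' (X : 'I_g -> 'M[C]_n) : r <= r' -> opball r X -> opball r' X.
Proof. by move=> rr Xr v; apply: (le_trans (Xr v)); rewrite ler_wpM2r ?ip_ge0. Qed.

(* The slack in [M * r < 1] keeps this open; unlike a bound on the Frobenius norm
   it is also stable under direct sums. *)
Definition strict_ball (M : C) n (X : 'I_g -> 'M[C]_n) : Prop :=
  exists r, [/\ 0 < r, M * r < 1 & opball r X].

Variable M : C.
Hypothesis M0 : 0 < M.

Lemma strict_ball0 n : strict_ball M (fun=> 0 : 'M[C]_n).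
Proof.
exists (2 * M)^-1; split; first by rewrite invr_gt0 mulr_gt0.
  by rewrite invfM mulrCA divff ?gt_eqF // mulr1 invf_lt1 ?ltr1n.
move=> v; rewrite big1 => [|j _]; last by rewrite /ip !mul0mx mulmx0 mxtrace0.
by rewrite mulr_ge0 ?ip_ge0 // invr_ge0 mulr_ge0 // ltW.
Qed.

Lemma strict_ball_dsum n m (X : 'I_g -> 'M[C]_n) (Y : 'I_g -> 'M[C]_m) :
  strict_ball M X -> strict_ball M Y -> strict_ball M (dsum X Y).
Proof.
move=> [r [r0 rM Xr]] [r' [r'0 r'M Yr]].
have [rr|rr] := real_leP (gtr0_real r0) (gtr0_real r'0).
  by exists r'; split=> //; apply: opball_dsum => //; apply: opball_le Xr.
by exists r; split=> //; apply: opball_dsum => //; apply: opball_le Yr; exact: ltW.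
Qed.

Lemma strict_ball_open n (X H : 'I_g -> 'M[C]_n) : strict_ball M X ->
  exists2 s0, 0 < s0 & forall s, 0 < s < s0 ->
    strict_ball M (fun j => X j + s *: H j)
    /\ strict_ball M (fun j => X j + (- s) *: H j).
Proof.
move=> [r [r0 rM Xr]]; have [h h0 Hh] := opball_bounded H.
(* [e] is the slack. For [s < 1] the perturbed radius is at most [r + s (r + 2 h)], costing at most
   [s t] after scaling by [M]; [s < e / (e + t)] ensures both [s < 1] and [s t < e]. *)
set e := 1 - M * r; have e0 : 0 < e by rewrite subr_gt0.
set t := M * (r + 2 * h).
have t0 : 0 < t by rewrite mulr_gt0 // ltr_wpDr // mulr_ge0.
have et0 : 0 < e + t by exact: addr_gt0.
exists (e / (e + t)); first exact: divr_gt0.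
move=> s /andP[s0 ss]; rewrite ltr_pdivlMr // in ss.
have st : 0 < s * t by exact: mulr_gt0.
have s1 : s < 1.
  rewrite -(ltr_pM2r e0) mul1r; apply: le_lt_trans ss.
  by rewrite ler_pM2l // lerDl ltW.
have ste : s * t < e.
  by apply: le_lt_trans ss; rewrite ler_pM2l // lerDr ltW.
set r' := (1 + s) * r + (s + s ^+ 2) * h.
have r'0 : 0 < r'.
  apply: ltr_wpDr; first by rewrite mulr_ge0 // addr_ge0 ?exprn_ge0 // ltW.
  by rewrite mulr_gt0 // addr_gt0.
have r'M : M * r' < 1.
  have r'le : r' <= r + s * (r + 2 * h).
    rewrite -subr_ge0; have -> : r + s * (r + 2 * h) - r' = s * h * (1 - s).
      by rewrite /r'; ring.
    by rewrite mulr_ge0 ?subr_ge0 ?(ltW s1) // mulr_ge0 // ltW.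
  rewrite (le_lt_trans (_ : _ <= M * (r + s * (r + 2 * h)))) ?ler_pM2l //.
  by rewrite -subr_gt0; move: ste; rewrite -subr_gt0; congr (0 < _); rewrite /e /t; ring.
have [Hp Hm] := opball_perturb (ltW s0) Xr Hh.
by split; exists r'.
Qed.

(** The limit [s -> 0] without topology: if [y > 0], the explicit choice [s = s0 y / (2 D)] with
    [D = y + s0 m] lies below [s0] and has [s m < y]. *)
Lemma le0_of_small (y s0 m : C) : y \is Num.real -> 0 < s0 -> 0 <= m ->
  (forall s, 0 < s < s0 -> y <= s * m) -> y <= 0.
Proof.
move=> yR s00 m0 ysm; rewrite real_leNgt //; apply/negP => y0.
set D := y + s0 * m.
have D0 : 0 < D by rewrite ltr_wpDr // mulr_ge0 // ltW.
have yD0 : 0 < y / D by exact: divr_gt0.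
have y_lt : s0 * (y / D) / 2 < s0.
  rewrite ltr_pdivrMr // ltr_pM2l //; apply: (@le_lt_trans _ _ 1); last by rewrite ltr1n.
  by rewrite ler_pdivrMr // mul1r lerDl mulr_ge0 // ltW.
have y_gt : 0 < s0 * (y / D) / 2 by rewrite divr_gt0 // mulr_gt0.
have := ysm _ (introT andP (conj y_gt y_lt)); apply/negP.
rewrite -real_ltNge //; last first.
  by rewrite rpredM // ?(gtr0_real y_gt) // ger0_real.
have -> : s0 * (y / D) / 2 * m = y * ((s0 * m) / (2 * D)).
  by field; rewrite ?gt_eqF.
rewrite -[X in _ < X]mulr1 ltr_pM2l // ltr_pdivrMr ?mulr_gt0 // mul1r.
have -> : s0 * m = D - y by rewrite /D; ring.
rewrite -subr_gt0; have -> : 2 * D - (D - y) = D + y by clearbody D; ring.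
exact: addr_gt0.
Qed.

End Perturbation.

(** * Convexity implies positivity of K on the ranges *)

Section Necessity.
Variables (C : numClosedFieldType) (g d : nat).
Variables (K : 'M[C]_d) (B : 'I_g -> 'M[C]_d) (c : 'cV[C]_d).
Hypothesis Ksig : signature_mx K.
Variable M : C.
Hypothesis M0 : 0 < M.
Hypothesis Mlam : 4 * lam_bound B <= M.

Lemma strict_ball_contraction n (X : 'I_g -> 'M[C]_n) :
  strict_ball M X -> contraction B X.
Proof.
move=> [r [r0 rM Xr]]; apply: opball_contraction Xr => //.
by apply: le_trans (ltW rM); rewrite ler_pM2r.
Qed.

(** The size [n] is left free, so that solutions can be juxtaposed through direct sums of tuples,
    enlarging the column space. *)
Definition attained n (Z : 'M[C]_(d, n)) : Prop :=
  exists X (w : 'rV[C]_n), strict_ball M X /\ pen K B X Z = c *m w.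

Lemma attained_row_mx n m (Z : 'M[C]_(d, n)) (W : 'M[C]_(d, m)) :
  attained Z -> attained W -> attained (row_mx Z W).
Proof.
move=> [X [w [XM XZ]]] [Y [v [YM YW]]]; exists (dsum X Y), (row_mx w v).
split; first exact: strict_ball_dsum.
by rewrite /pen lam_dsum !mul_mx_row opp_row_mx add_row_mx -XZ -YW.
Qed.

Lemma attained_Kc : attained (K *m c).
Proof.
have [_ KK] := Ksig.
exists (fun=> 0), 1%:M; split; first exact: strict_ball0.
by rewrite /pen lam0 subr0 mulmxA KK mul1mx mulmx1.
Qed.

(** Ranks are bounded by [d], so some attained [Z] has maximal rank. Juxtaposing [W] keeps it
    attained and cannot raise the rank, so the columns of [W] are already spanned. *)
Lemma attained_maximal : exists n (Z : 'M[C]_(d, n)), attained Z /\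
  forall m (W : 'M[C]_(d, m)), attained W -> (W^T <= Z^T)%MS.
Proof.
pose P k := boolp.asbool (exists n (Z : 'M[C]_(d, n)), attained Z /\ \rank Z = k).
have exP : exists k, P k.
  exists (\rank (K *m c)); apply/boolp.asboolP; exists 1, (K *m c).
  by split=> //; exact: attained_Kc.
have leP k : P k -> (k <= d)%N.
  by move=> /boolp.asboolP[n [Z [_ <-]]]; exact: rank_leq_row.
case: (ex_maxnP exP leP) => k /boolp.asboolP[n [Z [Za Zk]]] kmax.
exists n, Z; split=> // m W Wa.
have /kmax : P (\rank (row_mx Z W)).
  apply/boolp.asboolP; exists (n + m)%N, (row_mx Z W).
  by split=> //; exact: attained_row_mx.
rewrite -Zk -mxrank_tr tr_row_mx -(mxrank_tr Z) => rk.
have ZZW : (Z^T <= col_mx Z^T W^T)%MS by rewrite -addsmxE addsmxSl.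
rewrite (geq_leqif (mxrank_leqif_sup ZZW)) in rk.
by apply: submx_trans rk; rewrite -addsmxE addsmxSr.
Qed.

(* [Wp] and [Wm] are the difference quotients of the solution along [+ s H] and
   [- s H]; they converge weakly to [row_mx 0 (K *m u)] on the added coordinate. *)
Lemma perturbation n (X : 'I_g -> 'M[C]_n) (w : 'rV[C]_n) Z (a b : 'I_g -> 'cV[C]_n)
    (y : 'cV[C]_d) :
  strict_ball M X -> pen K B X Z = c *m w ->
  let u := \sum_j (B j *m (Z *m a j) + adjt B j *m (Z *m b j)) in
  exists s0 m, [/\ 0 < s0, 0 <= m & forall s, 0 < s < s0 ->
    exists Xp Xm Wp Wm, [/\
      [/\ strict_ball M Xp, strict_ball M Xm &
          pen K B (midpoint Xp Xm) (row_mx Z 0) = c *m row_mx w 0],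
      pen K B Xp (row_mx Z 0 + s *: Wp) = c *m row_mx w 0
      /\ pen K B Xm (row_mx Z 0 - s *: Wm) = c *m row_mx w 0,
      pen K B Xp Wp = row_mx 0 u /\ pen K B Xm Wm = row_mx 0 u
      & `|ip (row_mx 0 y) Wp - ip (K *m y) u| <= s * m
        /\ `|ip (row_mx 0 y) Wm - ip (K *m y) u| <= s * m]].
Proof.
move=> XM XZ u; have [/herm_adj KH KK] := Ksig.
set X' := dsum X (fun=> 0 : 'M[C]_1); set H := offdiag a b.
set q := row_mx 0 u; set Z' := row_mx Z 0.
have X'M : strict_ball M X' by apply: strict_ball_dsum => //; exact: strict_ball0.
have [s0 s00 sX] := strict_ball_open M0 H X'M.
(* [W0] solves the unperturbed equation with right side [row_mx 0 y]. Moving the Hermitian pencil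
   from [W] onto [W0] makes the error exactly [e * ip (lam B H W0) W]. *)
set W0 := row_mx 0 (K *m y) : 'M[C]_(d, n + 1).
(* By [ip_norm_le] and [contraction_bound], [m] dominates that inner product uniformly in [s]. *)
set m := ip (lam B H W0) (lam B H W0) + 4 * ip q q.
exists s0, m; split=> //; first by rewrite addr_ge0 ?mulr_ge0 ?ip_ge0.
move=> s s_small; have /andP[sp _] := s_small.
have [XpM XmM] := sX s s_small.
set Xp := (fun j => X' j + s *: H j) in XpM.
set Xm := (fun j => X' j + (- s) *: H j) in XmM.
have penX' : pen K B X' Z' = c *m row_mx w 0.
  rewrite /pen lam_dsum lam0 !mul_mx_row opp_row_mx add_row_mx !mulmx0 subr0.
  by rewrite -XZ.
have penH : lam B H Z' = q by exact: lam_offdiag.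
have penW0 : pen K B X' W0 = row_mx 0 y.
  rewrite /pen lam_dsum lam0 -(scale0r 0) lamZ !scale0r mul_mx_row opp_row_mx.
  by rewrite add_row_mx mulmx0 !subr0 mulmxA KK mul1mx.
have main e (Xe := (fun j => X' j + e *: H j)) : e^* = e -> `|e| = s ->
    strict_ball M Xe -> exists W,
      [/\ pen K B Xe W = q, pen K B Xe (Z' + e *: W) = c *m row_mx w 0 &
          `|ip (row_mx 0 y) W - ip (K *m y) u| <= s * m].
  move=> eE es XeM; have Xec := strict_ball_contraction XeM.
  have [W XeW] := resolvent_ex q (contraction_domain Ksig Xec).
  rewrite -/(pen K B Xe W) in XeW.
  have lamXe V : lam B Xe V = lam B X' V + e *: lam B H V.
    by rewrite lam_add lam_scale //; exact/CrealP.
  have penXe V : pen K B Xe V = pen K B X' V - e *: lam B H V.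
    by rewrite /pen lamXe opprD addrA.
  exists W; split=> //.
    (* The perturbation moves the value at [Z'] by [- e *: q], and the correction [e *: W] restores
       it exactly. *)
    by rewrite penD penZ XeW penXe penX' penH subrK.
  have -> : ip (row_mx 0 y) W - ip (K *m y) u = e * ip (lam B H W0) W.
    have -> : ip (K *m y) u = ip W0 q.
      by rewrite ip_row -(scale0r 0) ipZr mul0r add0r.
    have -> : row_mx 0 y = pen K B Xe W0 + e *: lam B H W0 by rewrite penXe subrK.
    rewrite ipDl ipZl eE -pen_herm // XeW.
    by rewrite addrC addKr.
  rewrite normrM es ler_pM2l //; apply: (le_trans (ip_norm_le _ _)).
  by rewrite lerD2l (contraction_bound Ksig Xec XeW).
have sR : s^* = s by apply/CrealP; exact: gtr0_real.
have [Wp [Wp1 Wp2 Wp3]] := main s sR (gtr0_norm sp) XpM.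
have mR : (- s)^* = - s by rewrite rmorphN /= sR.
have mN : `|- s| = s by rewrite normrN gtr0_norm.
have [Wm [Wm1 Wm2 Wm3]] := main (- s) mR mN XmM.
exists Xp, Xm, Wp, Wm; split=> //; split=> //; last by rewrite -scaleNr.
rewrite -penX'; congr (pen K B _ _); apply: boolp.funext => j.
rewrite /midpoint /Xp /Xm addrACA -scalerDl subrr scale0r addr0 -mulr2n.
by rewrite -scaler_nat scalerA mulVf ?pnatr_eq0 // scale1r.
Qed.

(** The double orthogonal complement: the conjugated columns of [cokermx Z^T] are orthogonal to the
    columns of [Z], and pairing [y] with them tests membership. *)
Lemma colspan_dual n (Z : 'M[C]_(d, n)) (y : 'cV[C]_d) :
  (forall x : 'cV[C]_d, Z^t* *m x = 0 -> ip x y = 0) -> (y^T <= Z^T)%MS.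
Proof.
move=> Zy; rewrite submxE; apply/eqP.
move: (cokermx Z^T) (mulmx_coker Z^T) => N ZN; apply/matrixP=> i k.
pose x := ((col k N)^t*)^T.
have Zx : Z^t* *m x = 0.
  apply/matrixP=> a b; move/matrixP/(_ a k): ZN; rewrite !mxE => ZN.
  transitivity ((\sum_j Z^T a j * N j k)^*); last by rewrite ZN conjC0.
  by rewrite rmorph_sum; apply: eq_bigr => j _; rewrite !mxE rmorphM.
rewrite [RHS]mxE; transitivity (ip x y); last exact: Zy.
rewrite ipE big_ord1 (ord1 i) mxE.
by apply: eq_bigr => j _; rewrite !mxE conjCK mulrC.
Qed.

(** Let [y] be orthogonal to the columns of [Z]. By maximality the added column of each perturbed
    solution is spanned by [Z], hence orthogonal to [y]; divided by [s], its pairing with [y]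
    approaches [<K y, u>], which must vanish. *)
Lemma maximal_invariant n (Z : 'M[C]_(d, n)) (a b : 'I_g -> 'cV[C]_n) :
  attained Z -> (forall m (W : 'M[C]_(d, m)), attained W -> (W^T <= Z^T)%MS) ->
  ((K *m \sum_j (B j *m (Z *m a j) + adjt B j *m (Z *m b j)))^T <= Z^T)%MS.
Proof.
move=> [X [w [XM XZ]]] Zmax; apply: colspan_dual => y Zy.
have [/herm_adj KH _] := Ksig.
have [s0 [m [s00 m0 pert]]] := perturbation a b y XM XZ.
set u := \sum_j _ in pert *.
apply/eqP; rewrite -normr_eq0 eq_le normr_ge0 andbT.
apply: (le0_of_small (normr_real _) s00 m0) => s ss.
have [Xp [_ [Wp [_ [[XpM _ _] [Zp _] _ [+ _]]]]]] := pert s ss.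
have /Zmax : attained (row_mx Z 0 + s *: Wp) by exists Xp, (row_mx w 0).
rewrite -[Wp]hsubmxK scale_row_mx add_row_mx tr_row_mx add0r.
rewrite -addsmxE addsmx_sub => /andP[_ /submxP[D /(congr1 trmx)]].
rewrite trmxK trmx_mul trmxK => sW.
have /andP[s_gt0 _] := ss.
rewrite ip_row -{1}(scale0r 0) ipZl rmorph0 mul0r add0r.
suff -> : ip y (rsubmx Wp) = 0 by rewrite sub0r normrN ip_mull KH.
have s_neq0 : s != 0 by rewrite gt_eqF.
apply: (mulfI s_neq0); rewrite mulr0 -ipZr sW ip_mull Zy.
by rewrite -(scale0r 0) ipZl rmorph0 mul0r.
Qed.

Hypothesis Bmin : minimal_realization K B c.

Lemma maximal_full n (Z : 'M[C]_(d, n)) :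
  attained Z -> (forall m (W : 'M[C]_(d, m)), attained W -> (W^T <= Z^T)%MS) ->
  forall v : 'cV[C]_d, exists a, v = Z *m a.
Proof.
move=> Za Zmax; have [_ KK] := Ksig.
have spanP (v : 'cV[C]_d) : (v^T <= Z^T)%MS -> exists a, v = Z *m a.
  by move=> /submxP[D /(congr1 trmx)]; rewrite trmxK trmx_mul trmxK; exists D^T.
(* Induction on the word: a new letter [B j *m K] or [adjt B j *m K] is applied to a vector that [K]
   sends to some [Z *m a], and a family supported at [j] fits [maximal_invariant]. *)
have span_words ws : ((K *m (word_mx K B ws *m c))^T <= Z^T)%MS.
  elim: ws => [|l ws /spanP[a aE]].
    by rewrite /word_mx big_nil mul1mx Zmax //; exact: attained_Kc.
  rewrite /word_mx big_cons -/(word_mx K B ws) -[_ *m _ *m c]mulmxA.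
  have step (A B' : 'I_g -> 'cV[C]_n) (j : 'I_g) (T : 'M[C]_d) :
      T *m (Z *m a) = \sum_j (B j *m (Z *m A j) + adjt B j *m (Z *m B' j)) ->
      ((K *m (T *m K *m (word_mx K B ws *m c)))^T <= Z^T)%MS.
    by move=> TE; rewrite -(mulmxA T) aE TE maximal_invariant.
  case: l => j.
    apply: (step (fun i => if i == j then a else 0) (fun=> 0) j).
    rewrite (bigD1 j) //= eqxx !mulmx0 addr0 big1 ?addr0 // => i /negPf ->.
    by rewrite !mulmx0 addr0.
  apply: (step (fun=> 0) (fun i => if i == j then a else 0) j).
  rewrite (bigD1 j) //= eqxx !mulmx0 add0r big1 ?addr0 // => i /negPf ->.
  by rewrite !mulmx0 addr0.
(* The spanned vectors carry a leading [K], so minimality is applied to [K *m v] and [K *m K = 1]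
   returns [v]. *)
move=> v; apply: spanP; have [ws [al vE]] := Bmin (K *m v).
rewrite -[v]mul1mx -KK -mulmxA vE mulmx_sumr linear_sum summx_sub // => w _.
by rewrite -scalemxAr linearZ /= scalemx_sub.
Qed.

Hypothesis convex_form : forall n (X Y : 'I_g -> 'M[C]_n) (w : 'rV[C]_n),
  strict_ball M X -> strict_ball M Y ->
  0 <= ((vecz w)^t* *m (2^-1 *: (realization K B c X + realization K B c Y)
     - realization K B c (midpoint X Y)) *m vecz w) 0 0.

Lemma range_psd (a b : 'I_g -> 'cV[C]_d) u :
  u = \sum_j (B j *m a j + adjt B j *m b j) -> 0 <= ip u (K *m u).
Proof.
have [/herm_adj KH _] := Ksig.
have [n [Z [Za Zmax]]] := attained_maximal.
have Zfull := maximal_full Za Zmax; have [X [w [XM XZ]]] := Za.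
have [al alE] := boolp.choice (fun j => Zfull (a j)).
have [be beE] := boolp.choice (fun j => Zfull (b j)).
move=> uE0; have uE : u = \sum_j (B j *m (Z *m al j) + adjt B j *m (Z *m be j)).
  by rewrite uE0; apply: eq_bigr => j _; rewrite -alE -beE.
(* Testing against [y = u] makes the limiting value the quadratic form of [K] at [u]. *)
have [s0 [m [s00 m0 pert]]] := perturbation al be u XM XZ.
rewrite -uE in pert; rewrite ip_mull KH.
have kR : ip (K *m u) u \is Num.real by apply/CrealP; rewrite ip_conj ip_mull KH.
suff : - ip (K *m u) u <= 0 by rewrite oppr_le0.
apply: (le0_of_small _ s00 m0); first by rewrite rpredN.
move=> s ss; have /andP[s_gt0 _] := ss; have s0' : s != 0 by rewrite gt_eqF.
have [Xp [Xm [Wp [Wm [[XpM XmM XZ'] [Zp Zm] [qp qm] [lp lm]]]]]] := pert s ss.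
have Xpc := strict_ball_contraction XpM; have Xmc := strict_ball_contraction XmM.
have form0 := convex_form (row_mx w 0) XpM XmM.
rewrite (realization_midpoint_form (contraction_domain Ksig Xpc)
  (contraction_domain Ksig Xmc)
  (contraction_domain Ksig (contraction_midpoint Xpc Xmc)) Zp Zm XZ') in form0.
(* The increments are [- s *: Wp] and [s *: Wm], so the gap is [s^2] times [ip Wp q + ip Wm q].
   Dividing by [s^2] leaves a nonnegative number within [2 s m] of twice the desired form. *)
have gap := convexity_gap Ksig Zp Zm XZ'.
have sR : s^* = s by apply/CrealP; exact: gtr0_real.
set q := row_mx 0 u in qp qm lp lm.
rewrite opprB (addrC (row_mx Z 0) (_ *: _ - _)) subrK in gap.
rewrite opprD addrA subrr sub0r -scaleNr !penZ qp qm !ipZr !ipZl rmorphN /= !sR in gap.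
have x0 : 0 <= ip Wp q + ip Wm q.
  rewrite -(pmulr_rge0 _ (exprn_gt0 2 s_gt0)).
  rewrite -(pmulr_rge0 _ (_ : 0 < 2)) ?ltr0n // in form0.
  have -> : s ^+ 2 * (ip Wp q + ip Wm q)
      = - s * (- s * ip Wp q) + s * (s * ip Wm q) by ring.
  by rewrite gap; move: form0; congr (0 <= _); field.
have conj_le W : `|ip q W - ip (K *m u) u| <= s * m -> `|ip W q - ip (K *m u) u| <= s * m.
  by rewrite -norm_conjC rmorphB /= ip_conj (CrealP kR).
have x_le := lerD (conj_le _ lp) (conj_le _ lm).
rewrite -(ler_pM2l (_ : 0 < 2)) ?ltr0n //.
apply: (@le_trans _ _ (ip Wp q + ip Wm q - 2 * ip (K *m u) u)).
  by rewrite mulrN lerDr.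
apply: le_trans (real_ler_norm _) _.
  by apply: rpredB; [exact: ger0_real | rewrite rpredM ?realn].
have -> : ip Wp q + ip Wm q - 2 * ip (K *m u) u
   = (ip Wp q - ip (K *m u) u) + (ip Wm q - ip (K *m u) u) by ring.
apply: (le_trans (ler_normD _ _)); apply: (le_trans x_le).
by rewrite [2 * _]mulr_natl mulr2n.
Qed.

End Necessity.

(** * From vectors in the ranges to the compression QKQ *)

Section Converse.
Variables (C : numClosedFieldType) (g d : nat).
Variables (K : 'M[C]_d) (B : 'I_g -> 'M[C]_d) (c : 'cV[C]_d).
Let Q := orthproj (rng B + rng (adjt B))%MS.
Hypothesis Ksig : signature_mx K.
Hypothesis Bmin : minimal_realization K B c.

Lemma rng_sumP (A : 'I_g -> 'M[C]_d) (x : 'rV[C]_d) : (x <= rng A)%MS ->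
  exists a : 'I_g -> 'cV[C]_d, x^T = \sum_j A j *m a j.
Proof.
move=> /sub_sumsmxP[D ->]; exists (fun j => (D j)^T).
by rewrite linear_sum; apply: eq_bigr => j _; rewrite /= trmx_mul trmxK.
Qed.

Lemma convex_near_0_psd : convex_near_0 K B c -> possemidef (Q *m K *m Q).
Proof.
move=> [eps [eps0 _ conv]]; have [/herm_adj KH _] := Ksig.
have [_ _ QU] := orthprojP (rng B + rng (adjt B))%MS; rewrite -/Q in QU.
have QH : Q^t* = Q by exact: orthproj_adj.
have b0 : 0 <= 4 * lam_bound B by rewrite mulr_ge0 // lam_bound_ge0.
have e0 : 0 < (eps ^+ 2)^-1 by rewrite invr_gt0 exprn_gt0.
(* The condition [M * r < 1] then gives both [r < eps ^+ 2], for the convexity ball, and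
   [4 * lam_bound B * r <= 1], for contraction. *)
set M := (eps ^+ 2)^-1 + 4 * lam_bound B.
have M0 : 0 < M by rewrite ltr_wpDr.
have Mlam : 4 * lam_bound B <= M by rewrite lerDr ltW.
have ball n (X : 'I_g -> 'M[C]_n) : strict_ball M X -> free_ball eps X.
  move=> [r [r0 rM Xr]]; apply: opball_free_ball Xr => //.
  rewrite -(ltr_pM2l e0) mulVf ?gt_eqF ?exprn_gt0 //.
  by apply: le_lt_trans rM; rewrite ler_pM2r // lerDl.
split=> [|v].
  by apply/herm_adj; rewrite !ctrM QH KH mulmxA.
have -> : v^t* *m (Q *m K *m Q) *m v = (Q *m v)^t* *m (K *m (Q *m v)).
  by rewrite ctrM QH !mulmxA.
rewrite -ip00.
have /sub_addsmxP[[D1 D2] /= uE] : ((Q *m v)^T <= rng B + rng (adjt B))%MS.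
  by rewrite -QU trmx_mul submxMl.
have [a aE] := rng_sumP (submxMl D1 (rng B)).
have [b bE] := rng_sumP (submxMl D2 (rng (adjt B))).
have QvE : Q *m v = \sum_j (B j *m a j + adjt B j *m b j).
  by rewrite -[LHS]trmxK uE linearD /= aE bE big_split.
apply: (range_psd Ksig M0 Mlam Bmin _ QvE) => n X Y w.
by move=> /ball Xb /ball Yb; have [_] := conv n X Y Xb Yb; apply.
Qed.

End Converse.

Theorem theorem1p6 (R : realType) (g d : nat)
    (K : 'M[R[i]]_d) (B : 'I_g -> 'M[R[i]]_d) (c : 'cV[R[i]]_d)
    (Ksig : signature_mx K) (Bmin : minimal_realization K B c) :
  let Q := orthproj (rng B + rng (adjt B))%MS in
  convex_near_0 K B c <-> possemidef (Q *m K *m Q).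
Proof.
split; [exact: convex_near_0_psd | exact: psd_convex_near_0].
Qed.
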